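(* Let $\sigma>1$, and for $\tau>0$ let $M_p^{\tau,\sigma}=p^{\tau p^\sigma}$ for $p\in\mathbb N$, $M_0^{\tau,\sigma}=1$, and let $\mathcal M_\sigma=\{(M_p^{\tau,\sigma})_{p\in\mathbb N_0}:\tau>0\}$. Then, both in the Roumieu case ($[\mathcal M_\sigma]=\{\mathcal M_\sigma\}$) and in the Beurling case ($[\mathcal M_\sigma]=(\mathcal M_\sigma)$), $$\mathcal S_{[\mathcal M_\sigma]}^{[\mathcal M_\sigma]}(\mathbb R^n)=\mathcal S_{[\mathcal M_\sigma],2}^{[\mathcal M_\sigma]}(\mathbb R^n).$$
   Context: All spaces consist of functions $\varphi\in C^\infty(\mathbb R^n)$; $\alpha,\beta$ denote multi-indices in $\mathbb N_0^n$ and $\|\cdot\|_{L^2}$ is the usual $L^2(\mathbb R^n)$-norm. - $\varphi\in\mathcal S_{\{\mathcal M_\sigma\}}^{\{\mathcal M_\sigma\}}(\mathbb R^n)$ iff $(\exists\tau>0)(\exists C>0)(\forall\alpha,\beta)\ \sup_{x\in\mathbb R^n}|x^\alpha\partial^\beta\varphi(x)|\le C M^{\tau,\sigma}_{|\alpha|}M^{\tau,\sigma}_{|\beta|}$. - $\varphi\in\mathcal S_{(\mathcal M_\sigma)}^{(\mathcal M_\sigma)}(\mathbb R^n)$ iff $(\forall\tau>0)(\exists C>0)(\forall\alpha,\beta)\ \sup_{x\in\mathbb R^n}|x^\alpha\partial^\beta\varphi(x)|\le C M^{\tau,\sigma}_{|\alpha|}M^{\tau,\sigma}_{|\beta|}$.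 - $\varphi\in\mathcal S_{\{\mathcal M_\sigma\},2}^{\{\mathcal M_\sigma\}}(\mathbb R^n)$ iff $(\exists\tau>0)(\exists C>0)(\forall\alpha,\beta)\ \|x^\alpha\partial^\beta\varphi(x)\|_{L^2}\le C M^{\tau,\sigma}_{|\alpha|}M^{\tau,\sigma}_{|\beta|}$. - $\varphi\in\mathcal S_{(\mathcal M_\sigma),2}^{(\mathcal M_\sigma)}(\mathbb R^n)$ iff $(\forall\tau>0)(\exists C>0)(\forall\alpha,\beta)\ \|x^\alpha\partial^\beta\varphi(x)\|_{L^2}\le C M^{\tau,\sigma}_{|\alpha|}M^{\tau,\sigma}_{|\beta|}$. *)

(* Defs.v *)
From HB Require Import structures.
From mathcomp Require Import all_boot all_order all_algebra.
From mathcomp Require Import all_classical all_reals all_analysis.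
From mathcomp Require Import complex.

Set Implicit Arguments.
Unset Strict Implicit.
Unset Printing Implicit Defensive.
Import Order.TTheory GRing.Theory Num.Theory.
Import numFieldNormedType.Exports.

Local Open Scope classical_set_scope.
Local Open Scope ring_scope.
Local Open Scope complex_scope.

(* Lebesgue measure on R^n. The library has a sigma-algebra on [n.-tuple T]
   (generated by the coordinates) but no n-fold product measure; it is built
   here as the n-fold iterate of the product [\x], transported along
   (x, t) |-> x :: t. *)
Section tuple_measure.
Context {d : measure_display} {T : measurableType d} {R : realType} {n : nat}.
Local Open Scope ereal_scope.

Definition tcons (p : T * n.-tuple T) : n.+1.-tuple T := [tuple of p.1 :: p.2].

Definition tuncons (t : n.+1.-tuple T) : T * n.-tuple T :=
  (thead t, [tuple of behead t]).

Lemma tconsK : cancel tcons tuncons.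
Proof. by case=> x t; congr pair; apply/val_inj. Qed.

Lemma tunconsK : cancel tuncons tcons.
Proof. by move=> t; rewrite [t in RHS]tuple_eta. Qed.

Lemma measurable_tcons : measurable_fun [set: T * n.-tuple T] tcons.
Proof. exact: measurable_cons. Qed.

Lemma measurable_tuncons : measurable_fun [set: n.+1.-tuple T] tuncons.
Proof.
apply/measurable_fun_pairP; split; first exact: measurable_tnth.
exact: measurable_behead.
Qed.

Variables (m1 : {sigma_finite_measure set T -> \bar R})
  (m2 : {sigma_finite_measure set (n.-tuple T) -> \bar R}).

Definition tuple_product : set (n.+1.-tuple T) -> \bar R :=
  pushforward (m1 \x m2) tcons.

Let tuple_product0 : tuple_product set0 = 0.
Proof. by rewrite /tuple_product /pushforward preimage_set0 measure0. Qed.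

Let tuple_product_ge0 A : 0 <= tuple_product A.
Proof. by rewrite /tuple_product /pushforward measure_ge0. Qed.

Let tuple_product_sigma_additive : semi_sigma_additive tuple_product.
Proof.
move=> F mF tF mUF; rewrite /tuple_product /pushforward preimage_bigcup.
have mp A : measurable A -> measurable (tcons @^-1` A).
  by move=> mA; rewrite -[X in measurable X]setTI; exact: measurable_tcons.
apply: measure_semi_sigma_additive.
- by move=> i; exact: mp.
- by move=> i j _ _ [p [Fip Fjp]]; apply: tF => //; exists (tcons p).
- by rewrite -preimage_bigcup; exact: mp.
Qed.

HB.instance Definition _ := isMeasure.Build _ _ _ tuple_product
  tuple_product0 tuple_product_ge0 tuple_product_sigma_additive.

Let tuple_product_sigma_finite : sigma_finite setT tuple_product.
Proof.
have /sigma_finiteP[F [FT ndF Foo]] := sigma_finiteT m1.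
have /sigma_finiteP[G [GT ndG Goo]] := sigma_finiteT m2.
exists (fun k => tuncons @^-1` (F k `*` G k)).
  rewrite -preimage_bigcup; apply/esym; rewrite -subTset => t _.
  have [k _ Fk] : (\bigcup_k F k) (tuncons t).1 by rewrite -FT.
  have [l _ Gl] : (\bigcup_k G k) (tuncons t).2 by rewrite -GT.
  exists (maxn k l) => //; split.
    by move: Fk; exact/subsetPset/ndF/leq_maxl.
  by move: Gl; exact/subsetPset/ndG/leq_maxr.
move=> k; have [mF Fk] := Foo k; have [mG Gk] := Goo k; split.
  rewrite -[X in measurable X]setTI; apply: measurable_tuncons => //.
  exact: measurableX.
rewrite /tuple_product /pushforward -comp_preimage.
have -> : tuncons \o tcons = id by apply/funext => p; exact: tconsK.
by rewrite preimage_id product_measure1E// lte_mul_pinfty// ge0_fin_numE.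
Qed.

HB.instance Definition _ := Measure_isSigmaFinite.Build _ _ _ tuple_product
  tuple_product_sigma_finite.

End tuple_measure.

Fixpoint lebesgue_tuple (R : realType) (n : nat) :
    {sigma_finite_measure set (n.-tuple (measurableTypeR R)) -> \bar R} :=
  match n with
  | 0 => \d_ [tuple]
  | m.+1 => tuple_product lebesgue_measure (lebesgue_tuple R m)
  end.

(* This determines [lebesgue_tuple] as Lebesgue measure on the Borel sets of R^n. *)
Lemma lebesgue_tuple_box (R : realType) (n : nat)
    (A : 'I_n -> set (measurableTypeR R)) :
  (forall i, measurable (A i)) ->
  lebesgue_tuple R n [set t | forall i, A i (tnth t i)] =
  (\prod_(i < n) lebesgue_measure (A i))%E.
Proof.
elim: n A => [|n IHn] A mA.
  by rewrite big_ord0 /= diracE mem_set// => -[].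
rewrite big_ord_recl -IHn// /= /tuple_product /pushforward.
set B := [set t | forall i : 'I_n, A (lift ord0 i) (tnth t i)].
have mB : measurable B.
  rewrite (_ : B = \bigcap_(i : 'I_n) ((@tnth _ _)^~ i @^-1` A (lift ord0 i))).
    apply: fin_bigcap_measurable => // i _.
    by rewrite -[X in measurable X]setTI; exact: measurable_tnth.
  by apply/seteqP; split=> t Bt i => [_|]; exact: Bt.
rewrite -product_measure1E//; congr (_ _).
apply/seteqP; split=> -[x t] /= => [At|[Ax Bt] i].
  split; first exact: (At ord0).
  by move=> i; have := At (lift ord0 i); rewrite tnthS.
case: (unliftP ord0 i) => [j|] ->; last by [].
by rewrite tnthS; exact: Bt.
Qed.

Section smooth_functions.
Context {R : realType} {n : nat}.
Implicit Types (f : 'rV[R]_n -> R) (phi : 'rV[R]_n -> R[i]).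

Definition partial (i : 'I_n) f : 'rV[R]_n -> R := 'D_(delta_mx 0 i) f.

Definition partials (s : seq 'I_n) f : 'rV[R]_n -> R := foldr partial f s.

(* 'D_v is a junk value where the limit of difference quotients does not
   exist, hence the explicit derivability requirement. *)
Definition smooth_real f : Prop :=
  forall s : seq 'I_n, continuous (partials s f) /\
    forall (x : 'rV[R]_n) (i : 'I_n), derivable (partials s f) x (delta_mx 0 i).

Definition smooth phi : Prop :=
  smooth_real (fun x => complex.Re (phi x)) /\
  smooth_real (fun x => complex.Im (phi x)).

(* The order in which the partial derivatives are taken is immaterial on
   smooth functions (Schwarz). *)
Definition mderiv_real (b : 'I_n -> nat) f : 'rV[R]_n -> R :=
  foldr (fun i => iter (b i) (partial i)) f (enum 'I_n).

Definition mderiv (b : 'I_n -> nat) phi (x : 'rV[R]_n) : R[i] :=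
  mderiv_real b (fun y => complex.Re (phi y)) x +i*
  mderiv_real b (fun y => complex.Im (phi y)) x.

Definition mdegree (a : 'I_n -> nat) : nat := (\sum_i a i)%N.

Definition monomial (a : 'I_n -> nat) (x : 'rV[R]_n) : R :=
  \prod_i x 0 i ^+ a i.

Definition weighted_deriv (a b : 'I_n -> nat) phi (x : 'rV[R]_n) : R[i] :=
  (monomial a x)%:C * mderiv b phi x.

Definition sup_norm phi : \bar R :=
  ereal_sup [set (Normc.normc (phi x))%:E | x in [set: 'rV[R]_n]].

Definition row_of_tuple (t : n.-tuple R) : 'rV[R]_n := \row_i tnth t i.

Definition L2_norm phi : \bar R :=
  Lnorm (lebesgue_tuple R n) 2%:E
    (fun t => (Normc.normc (phi (row_of_tuple t)))%:E).

End smooth_functions.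

Definition Mseq {R : realType} (tau sigma : R) (p : nat) : R :=
  if p is 0 then 1 else p%:R `^ (tau * p%:R `^ sigma).

Section spaces.
Context {R : realType}.
Variables (n : nat) (sigma : R).

Definition seminorm_bounds (N : ('rV[R]_n -> R[i]) -> \bar R) (tau C : R)
    (phi : 'rV[R]_n -> R[i]) : Prop :=
  forall a b : 'I_n -> nat,
    (N (weighted_deriv a b phi) <=
     (C * Mseq tau sigma (mdegree a) * Mseq tau sigma (mdegree b))%:E)%E.

Definition roumieu_space : set ('rV[R]_n -> R[i]) :=
  [set phi | smooth phi /\
    exists2 tau : R, 0 < tau &
    exists2 C : R, 0 < C & seminorm_bounds sup_norm tau C phi].

Definition beurling_space : set ('rV[R]_n -> R[i]) :=
  [set phi | smooth phi /\
    forall tau : R, 0 < tau ->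
    exists2 C : R, 0 < C & seminorm_bounds sup_norm tau C phi].

Definition roumieu_space_L2 : set ('rV[R]_n -> R[i]) :=
  [set phi | smooth phi /\
    exists2 tau : R, 0 < tau &
    exists2 C : R, 0 < C & seminorm_bounds L2_norm tau C phi].

Definition beurling_space_L2 : set ('rV[R]_n -> R[i]) :=
  [set phi | smooth phi /\
    forall tau : R, 0 < tau ->
    exists2 C : R, 0 < C & seminorm_bounds L2_norm tau C phi].

End spaces.

Arguments roumieu_space {R} n sigma.
Arguments beurling_space {R} n sigma.
Arguments roumieu_space_L2 {R} n sigma.
Arguments beurling_space_L2 {R} n sigma.

(* Main.v *)
Require Import Defs.
From mathcomp Require Import all_boot all_order all_algebra.
From mathcomp Require Import all_classical all_reals all_analysis.
From mathcomp Require Import complex.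
From mathcomp Require Import measurable_realfun ring lra.

(** Only finitely many extra derivatives or powers of x, a number depending on
    the dimension n alone, separate the sup norm of x^a D^b phi from its L^2
    norm. The defining sequences absorb such a shift: [Mseq_shift] says that
    replacing tau by 2^(sigma+1) tau compensates, up to a constant factor, for
    moving the index by at most n. As the change of tau is multiplication by a
    fixed positive factor, it is harmless both when some tau is required
    (Roumieu) and when all tau are (Beurling).

    From sup to L^2 ([L2_norm_le_sup]): at every point x the product of the
    1 + x_i^2 is at most 2^n times the square of a monomial of degree at most
    n, so |x^a D^b phi|^2 is dominated by a constant times the product of the
    1/(1 + x_i^2), whose integral is pi^n.

    From L^2 to sup ([sup_norm_le_L2]): this is a Sobolev inequality. On the
    line, integrating the derivative of (y - c) h(y)^2 over a unit interval
    ending at x gives h(x)^2 <= 2 int (h^2 + h'^2) over that interval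
    ([unit_interval_estimate]). Of the two unit intervals ending at x, the one
    pointing away from the origin is chosen: there |x^k| <= |y^k|, so the
    monomial weight moves under the integral sign without being differentiated
    ([weighted_line_estimate]), and no Leibniz formula is needed. Applying this
    to one coordinate after the other and using Tonelli's theorem
    ([iterated_line_bound]) bounds (x^a f)^2 by 2^n times the integral of the
    sum of the (x^a D^g f)^2 over all g with entries 0 and 1. With
    f = D^b phi, the derivatives that occur are reordered into the shape
    [mderiv_real] by Schwarz's theorem ([derive_swap]). *)

Set Implicit Arguments.
Unset Strict Implicit.
Unset Printing Implicit Defensive.
Import Order.TTheory GRing.Theory Num.Theory.
Import numFieldNormedType.Exports.

Local Open Scope classical_set_scope.
Local Open Scope ring_scope.

(** * Index shifts in the defining sequences *)

Section Mseq_theory.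
Context {R : realType}.
Implicit Types (t s : R).

Lemma Mseq_gt0 t s p : 0 < Mseq t s p.
Proof. by case: p => [|p]; rewrite /Mseq ?ltr01// powR_gt0. Qed.

Lemma Mseq_ge1 t s p : 0 < t -> 1 <= Mseq t s p.
Proof.
case: p => [|p] t0; rewrite /Mseq ?lexx//.
rewrite -[leLHS](powRr0 (p.+1%:R : R)).
by rewrite ler_powR ?ler1n// mulr_ge0 ?powR_ge0// ltW.
Qed.

(** Both bounds q <= 2p and q <= p^2 are used, the first in the exponent and
    the second in the base: q^(t q^s) <= (p^2)^(t (2p)^s), which is p to the
    power 2^(s+1) t p^s. *)
Lemma Mseq_shift_large t s p q : 0 < t -> 1 < s -> (1 < p)%N ->
  (q <= 2 * p)%N -> Mseq t s q <= Mseq (2 `^ (s + 1) * t) s p.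
Proof.
move=> t0 s1 p1 qp.
have s0 : 0 <= s by rewrite (le_trans ler01)// ltW.
have t'0 : 0 < 2 `^ (s + 1) * t by rewrite mulr_gt0 ?powR_gt0.
case: q qp => [|q] qp; first exact: Mseq_ge1.
case: p p1 qp => // p p1 qp; rewrite /Mseq.
set P : R := p.+1%:R; set Q : R := q.+1%:R.
have Q1 : 1 <= Q by rewrite ler1n.
have QP : Q <= 2 * P by rewrite -natrM ler_nat.
have QP2 : Q <= P `^ 2.
  rewrite powR_mulrn ?ler0n// expr2 (le_trans QP)// ler_wpM2r ?ler0n//.
  by rewrite ler_nat.
have P1 : 1 <= P by rewrite ler1n.
apply: (@le_trans _ _ (Q `^ (t * (2 * P) `^ s))).
  rewrite ler_powR// ler_wpM2l ?(ltW t0)// ge0_ler_powR// ?nnegrE//.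
  by rewrite mulr_ge0// ler0n.
apply: (@le_trans _ _ ((P `^ 2) `^ (t * (2 * P) `^ s))).
  rewrite ge0_ler_powR ?nnegrE ?powR_ge0 ?ler0n//.
  by rewrite mulr_ge0 ?powR_ge0 ?(ltW t0).
rewrite -powRrM powRM ?ler0n// powRD ?pnatr_eq0 ?implybT// powRr1 ?ler0n//.
by rewrite le_eqVlt; apply/orP; left; apply/eqP; congr (_ `^ _); ring.
Qed.

(** For p >= max(k, 2) the previous bound applies with D = 1, because
    p + k <= 2p; the finitely many remaining q are handled by adding up the
    values of the sequence there. *)
Lemma Mseq_shift t s k : 0 < t -> 1 < s ->
  exists2 D : R, 1 <= D & forall p q, (q <= p + k)%N ->
    Mseq t s q <= D * Mseq (2 `^ (s + 1) * t) s p.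
Proof.
move=> t0 s1.
have t'0 : 0 < 2 `^ (s + 1) * t by rewrite mulr_gt0 ?powR_gt0.
pose K := (maxn k 2 + k).+1.
have S0 : 0 <= \sum_(i < K) Mseq t s i.
  by apply: sumr_ge0 => i _; exact/ltW/Mseq_gt0.
exists (1 + \sum_(i < K) Mseq t s i); first by rewrite lerDl.
move=> p q qp; have [pk|kp] := ltnP p (maxn k 2).
  apply: (@le_trans _ _ (1 + \sum_(i < K) Mseq t s i)); last first.
    by rewrite ler_peMr ?Mseq_ge1// addr_ge0.
  have qK : (q < K)%N by rewrite ltnS (leq_trans qp)// leq_add2r ltnW.
  rewrite (bigD1 (Ordinal qK))//= addrCA lerDl addr_ge0//.
  by apply: sumr_ge0 => i _; exact/ltW/Mseq_gt0.
move: kp; rewrite geq_max => /andP[kp p2].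
apply: (@le_trans _ _ (Mseq (2 `^ (s + 1) * t) s p)).
  apply: Mseq_shift_large => //.
  by rewrite (leq_trans qp)// mul2n -addnn leq_add2l.
by rewrite ler_peMl ?lerDl// ltW// Mseq_gt0.
Qed.

End Mseq_theory.

(** * Derivatives along lines and Schwarz's theorem *)

Section directional.
Context {R : realType} {V : normedModType R}.
Implicit Types (f : V -> R) (p v : V).

Lemma is_derive_line f p v (t : R) : derivable f (p + t *: v) v ->
  is_derive t 1 (fun u : R => f (p + u *: v)) ('D_v f (p + t *: v)).
Proof.
move=> df.
have E : (fun h : R => h^-1 *: (f (p + (h *: 1 + t) *: v) - f (p + t *: v))) =
         (fun h : R => h^-1 *: (f (h *: v + (p + t *: v)) - f (p + t *: v))).
  by apply/funext => h; rewrite [h *: 1]mulr1 scalerDl addrCA.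
split; first by rewrite /derivable /= E.
by rewrite /derive /= E.
Qed.

Lemma continuous_line p v : continuous (fun u : R => p + u *: v).
Proof.
move=> u; apply: (@cvgD R V); first exact: cvg_cst.
exact: (@cvgZr_tmp R V R _ _ (fun u : R => u) u).
Qed.

End directional.
Section schwarz.
Context {R : realType} {V : normedModType R}.
Implicit Types (f : V -> R) (p v w : V).

Lemma MVT_everywhere (g dg : R -> R) (h : R) : 0 < h ->
  (forall t : R, is_derive t 1 g (dg t)) ->
  exists2 c, 0 <= c <= h & g h - g 0 = dg c * h.
Proof.
move=> h0 gdg.
have [c|c ch ->] := @MVT_segment R g dg 0 h (ltW h0) (fun c _ => gdg c).
  apply: continuous_subspaceT => {}c; apply: differentiable_continuous.
  by apply/derivable1_diffP; have [] := gdg c.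
by exists c; rewrite ?subr0// -[X in is_true X]/(c \in `[0, h]).
Qed.

(** The mean value theorem is applied twice: in the direction v to the
    increment of f by h w, then in the direction w to the derivative obtained.
    The left-hand side is symmetric in v and w up to the order of its terms. *)
Lemma second_difference f p v w (h : R) : 0 < h ->
  (forall x, derivable f x v) -> (forall x, derivable ('D_v f) x w) ->
  exists s t : R, [/\ 0 <= s <= h, 0 <= t <= h &
    f (p + h *: w + h *: v) - f (p + h *: v) - (f (p + h *: w) - f p) =
    'D_w ('D_v f) (p + (s *: v + t *: w)) * h * h].
Proof.
move=> h0 dv dw.
have [|s sh E] := @MVT_everywhere
    (fun s => f (p + h *: w + s *: v) - f (p + s *: v))
    (fun s => 'D_v f (p + h *: w + s *: v) - 'D_v f (p + s *: v)) h h0.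
  by move=> t; apply: is_deriveB; apply: is_derive_line.
have [|t th E'] := @MVT_everywhere
    (fun t => 'D_v f (p + s *: v + t *: w))
    (fun t => 'D_w ('D_v f) (p + s *: v + t *: w)) h h0.
  by move=> t; apply: is_derive_line.
exists s, t; split=> //.
move: E; rewrite !scale0r !addr0 => ->.
by move: E'; rewrite !scale0r !addr0 (addrAC p) => ->; rewrite addrA.
Qed.

(** The side h of the parallelogram at p is arbitrarily small, so by continuity
    G p and H p are arbitrarily close to one common value. *)
Lemma eq_nearby_values (G H : V -> R) p v w :
  continuous G -> continuous H ->
  (forall h : R, 0 < h -> exists s t s' t' : R,
    [/\ 0 <= s <= h, 0 <= t <= h, 0 <= s' <= h, 0 <= t' <= h &
    G (p + (s *: v + t *: w)) = H (p + (s' *: v + t' *: w))]) ->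
  G p = H p.
Proof.
move=> cG cH GH; apply/eqP/negPn/negP => neGH.
have e0 : 0 < `|G p - H p| / 2 by rewrite divr_gt0// normr_gt0 subr_eq0.
have /cvgrPdist_lt/(_ _ e0)/nbhs_ballP[d1 /= d10 H1] := cG p.
have /cvgrPdist_lt/(_ _ e0)/nbhs_ballP[d2 /= d20 H2] := cH p.
pose d := Num.min d1 d2; have d0 : 0 < d by rewrite lt_min d10.
have N0 : 0 < `|v| + `|w| + 1 by rewrite ltr_wpDl// addr_ge0.
(* the parallelogram of side h lies in the ball of radius d *)
pose h := d / (`|v| + `|w| + 1); have h0 : 0 < h by rewrite divr_gt0.
have near s t : 0 <= s <= h -> 0 <= t <= h -> ball p d (p + (s *: v + t *: w)).
  move=> /andP[s0 sh] /andP[t0 th].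
  rewrite -ball_normE /= opprD addrA subrr add0r normrN.
  rewrite (le_lt_trans (ler_normD _ _))//.
  rewrite !normrZ !ger0_norm// (@le_lt_trans _ _ (h * (`|v| + `|w|)))//.
    by rewrite mulrDr lerD// ler_wpM2r.
  by rewrite /h -mulrA gtr_pMr// mulrC ltr_pdivrMr// mul1r ltrDl.
have [s [t [s' [t' [sh th sh' th' E]]]]] := GH h h0.
have {}H1 : `|G p - G (p + (s *: v + t *: w))| < `|G p - H p| / 2.
  by apply: H1; apply: le_ball (near _ _ sh th); rewrite ge_min lexx.
have {}H2 : `|H p - H (p + (s' *: v + t' *: w))| < `|G p - H p| / 2.
  by apply: H2; apply: le_ball (near _ _ sh' th'); rewrite ge_min lexx orbT.
rewrite E in H1; rewrite distrC in H2.
have := le_lt_trans (ler_distD _ _ _) (ltrD H1 H2).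
by rewrite -splitr ltxx.
Qed.

(** Schwarz's theorem: the second difference of f at p with steps h v and h w
    equals h^2 times either mixed derivative, each taken at some point of the
    parallelogram. *)
Lemma derive_swap f v w :
  (forall x, derivable f x v) -> (forall x, derivable f x w) ->
  (forall x, derivable ('D_v f) x w) -> (forall x, derivable ('D_w f) x v) ->
  continuous ('D_w ('D_v f)) -> continuous ('D_v ('D_w f)) ->
  'D_w ('D_v f) = 'D_v ('D_w f).
Proof.
move=> fv fw fvw fwv cvw cwv; apply/funext => p.
apply: (@eq_nearby_values _ _ p v w cvw cwv) => h h0.
have [s [t [sh th E]]] := second_difference p h0 fv fvw.
have [t' [s' [th' sh' E']]] := second_difference p h0 fw fwv.
exists s, t, s', t'; split; [exact: sh|exact: th|exact: sh'|exact: th'|].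
apply: (mulIf (lt0r_neq0 h0)); apply: (mulIf (lt0r_neq0 h0)).
rewrite (addrC (s' *: v)); move: E E'.
move: ('D_w ('D_v f) _) ('D_v ('D_w f) _) => X Y <- <-.
have sub_swap (a b c d : R) : a - b - (c - d) = a - c - (b - d) by ring.
by rewrite sub_swap (addrAC p (h *: v)).
Qed.

End schwarz.

(** * Reordering iterated partial derivatives *)

Section smooth_functions.
Context {R : realType} {n : nat}.
Implicit Types (f : 'rV[R]_n -> R) (s t : seq 'I_n).

Lemma smooth_real_partial i f : smooth_real f -> smooth_real (partial i f).
Proof.
by move=> sf s; have := sf (s ++ [:: i]); rewrite /partials foldr_cat.
Qed.

Lemma smooth_real_partials s f : smooth_real f -> smooth_real (partials s f).
Proof. by move=> sf; elim: s => [//|i s IH]; exact: (smooth_real_partial i IH). Qed.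

Lemma partial_swap i j f : smooth_real f ->
  partial i (partial j f) = partial j (partial i f).
Proof.
move=> sf; apply: derive_swap => [x|x|x|x||].
- by have [_] := sf [::]; apply.
- by have [_] := sf [::]; apply.
- by have [_] := sf [:: j]; apply.
- by have [_] := sf [:: i]; apply.
- by have [] := sf [:: i; j].
- by have [] := sf [:: j; i].
Qed.

Lemma partials_cat s t f : partials (s ++ t) f = partials s (partials t f).
Proof. exact: foldr_cat. Qed.

Lemma partials_partial s i f : smooth_real f ->
  partials s (partial i f) = partial i (partials s f).
Proof.
move=> sf; elim: s => //= j s ->; apply: partial_swap.
exact: smooth_real_partials.
Qed.

Lemma partials_swap s t f : smooth_real f ->
  partials s (partials t f) = partials t (partials s f).
Proof.
move=> sf; elim: t => //= i t <-; apply: partials_partial.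
exact: smooth_real_partials.
Qed.

Lemma perm_partials s t f : smooth_real f -> perm_eq s t ->
  partials s f = partials t f.
Proof.
move=> sf st.
apply: (catCA_perm_ind _ st (P := fun u => partials s f = partials u f)) => //.
move=> s1 s2 s3 ->; rewrite !catA !(partials_cat _ s3).
rewrite !(partials_cat s1, partials_cat s2).
by apply: partials_swap; exact: smooth_real_partials.
Qed.

Lemma mderiv_realE (b : 'I_n -> nat) f :
  mderiv_real b f = partials (flatten [seq nseq (b i) i | i <- enum 'I_n]) f.
Proof.
rewrite /mderiv_real; elim: (enum 'I_n) => //= i s ->.
by rewrite partials_cat; elim: (b i) => //= m ->.
Qed.

Lemma partialsE s f : smooth_real f ->
  partials s f = mderiv_real (fun i => count_mem i s) f.
Proof.
move=> sf; rewrite mderiv_realE; apply: perm_partials => //.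
apply/allP => i _ /=; apply/eqP; rewrite count_flatten -map_comp sumnE big_map.
rewrite (bigD1_seq i) ?mem_enum ?enum_uniq//= count_nseq /= eqxx mul1n.
rewrite big1 ?addn0// => j /negbTE ji.
by rewrite count_nseq /= ji.
Qed.

Lemma mdegree_count s : mdegree (fun i => count_mem i s) = size s.
Proof.
elim: s => [|j s IH]; first by rewrite /mdegree big1.
rewrite /= -IH /mdegree big_split/= (bigD1 j)//= eqxx big1 ?addn0// => i.
by move=> /negbTE; rewrite eq_sym => ->.
Qed.

Lemma size_mderiv_seq (b : 'I_n -> nat) :
  size (flatten [seq nseq (b i) i | i <- enum 'I_n]) = mdegree b.
Proof.
rewrite size_flatten /shape -map_comp sumnE big_map big_enum /=.
by apply: eq_bigr => i _; rewrite size_nseq.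
Qed.

End smooth_functions.

(** * Measurability and integration on tuples *)

Section tuple_measurability.
Context {R : realType} {n : nat}.
Local Notation T := (n.-tuple (measurableTypeR R)).

(** The sigma-algebra on tuples is generated by the coordinates, so open sets
    are reached as countable unions of boxes with rational corners. *)
Lemma measurable_row_open (U : set 'rV[R]_n) : open U ->
  measurable [set t : T | U (row_of_tuple t)].
Proof.
move=> oU.
pose box (b : {ffun 'I_n -> rat * rat}) : set T :=
  [set t | forall i, ratr (b i).1 < tnth t i < ratr (b i).2].
have mbox b : measurable (box b).
  rewrite (_ : box b = \bigcap_(i : 'I_n)
      ((@tnth _ _)^~ i @^-1` `]ratr (b i).1, ratr (b i).2[%classic)).
    apply: fin_bigcap_measurable => // i _.
    by rewrite -[X in measurable X]setTI; exact: measurable_tnth.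
  by apply/seteqP; split=> t bt i => [_|]; have := bt i; rewrite /= in_itv //=; apply.
rewrite (_ : [set t | _] =
    \bigcup_b (if `[< box b `<=` [set t | U (row_of_tuple t)] >]
               then box b else set0)).
  apply: countable_bigcupT_measurable => [|b]; first exact: countableP.
  by case: ifP.
apply/seteqP; split=> [t Ut|t [b _]]; last first.
  by case: ifPn => // /asboolP; apply.
have /nbhs_ballP[e /= e0 eU] := open_nbhs_nbhs (conj oU Ut).
have pick (x : R) : {q : rat * rat |
    (x - e < ratr q.1 < x) && (x < ratr q.2 < x + e)}.
  have /cid[q1] := @rat_in_itvoo R (x - e) x ltac:(by rewrite ltrBlDr ltrDl).
  have /cid[q2] := @rat_in_itvoo R x (x + e) ltac:(by rewrite ltrDl).
  by rewrite !in_itv /= => h2 h1; exists (q1, q2); rewrite h1 h2.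
exists [ffun i => sval (pick (tnth t i))] => //; rewrite ifT; last first.
  apply/asboolP => u bu; apply: eU; split=> // j i.
  rewrite /ball /= !mxE; have := bu i; rewrite ffunE.
  case: (pick _) => -[q1 q2] /= /andP[/andP[h1 h2] /andP[h3 h4]] /andP[h5 h6].
  by rewrite ltr_distlC; apply/andP; split; [apply: lt_trans h5|apply: lt_trans h4].
move=> i; rewrite ffunE; case: (pick _) => -[q1 q2] /=.
by move=> /andP[/andP[_ ->] /andP[-> _]].
Qed.

Lemma measurable_row_continuous (f : 'rV[R]_n -> R) : continuous f ->
  measurable_fun [set: T] (fun t => f (row_of_tuple t)).
Proof.
move=> cf; apply: (measurability _ (RGenOInfty.measurableE R)).
move=> _ [_ [a ->] <-]; rewrite setTI.
rewrite [X in measurable X]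
  (_ : _ = [set t | (f @^-1` `]a, +oo[) (row_of_tuple t)])//.
apply: measurable_row_open; apply: open_comp => [x _|]; first exact: cf.
exact: interval_open.
Qed.

End tuple_measurability.

Section tuple_integral.
Context {R : realType}.
Local Notation mu := (@lebesgue_measure R).
Local Notation T n := (n.-tuple (measurableTypeR R)).
Local Open Scope ereal_scope.

Lemma integral_tuple0 (F : T 0%N -> \bar R) : measurable_fun setT F ->
  \int[lebesgue_tuple R 0%N]_t F t = F [tuple].
Proof. by move=> mF; rewrite /= integral_dirac// diracE in_setT mul1e. Qed.

Lemma integral_tupleS n (F : T n.+1 -> \bar R) : measurable_fun setT F ->
  (forall t, 0 <= F t) ->
  \int[lebesgue_tuple R n.+1]_t F t =
  \int[mu]_x \int[lebesgue_tuple R n]_t F (tcons (x, t)).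
Proof.
move=> mF F0.
rewrite [LHS](@ge0_integral_pushforward _ _ _ _ _ _ measurable_tcons)//.
rewrite preimage_setT fubini_tonelli1//.
  by apply: measurableT_comp => //; exact: measurable_tcons.
by move=> p; exact: F0.
Qed.

Lemma measurable_tcons_right n (F : T n.+1 -> \bar R) (x : R) :
  measurable_fun setT F -> measurable_fun setT (fun t => F (tcons (x, t))).
Proof.
move=> mF; apply: measurableT_comp => //.
by apply: measurableT_comp; [exact: measurable_tcons|exact: measurable_pair1].
Qed.

Lemma measurable_tcons_left n (F : T n.+1 -> \bar R) (t : T n) :
  measurable_fun setT F ->
  measurable_fun setT (fun x : measurableTypeR R => F (tcons (x, t))).
Proof.
move=> mF; apply: (@measurableT_comp _ _ _ _ _ _ F) => //.
apply: (@measurableT_comp _ _ _ _ _ _ tcons); first exact: measurable_tcons.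
exact: measurable_pair2.
Qed.

Lemma measurable_integral_tcons n (F : T n.+1 -> \bar R) :
  measurable_fun setT F -> (forall t, 0 <= F t) ->
  measurable_fun setT (fun x => \int[lebesgue_tuple R n]_t F (tcons (x, t))).
Proof.
move=> mF F0.
apply: (@measurable_fun_fubini_tonelli_F _ _ _ _ _ _ (F \o tcons)) => //.
  by apply: measurableT_comp => //; exact: measurable_tcons.
by move=> p; exact: F0.
Qed.

(** The position is a natural number, so that prepending an entry to the tuple
    shifts it by a successor. *)
Definition tupd n (t : T n) (k : nat) (y : R) : T n :=
  [tuple if i == k :> nat then y else tnth t i | i < n].

Lemma tupd0 n (x y : R) (t : T n) : tupd (tcons (x, t)) 0%N y = tcons (y, t).
Proof.
apply: eq_from_tnth => i; rewrite tnth_mktuple.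
by case: (unliftP ord0 i) => [j|] -> //=; rewrite !tnthS.
Qed.

Lemma tupdS n (x y : R) (t : T n) k :
  tupd (tcons (x, t)) k.+1 y = tcons (x, tupd t k y).
Proof.
apply: eq_from_tnth => i; rewrite tnth_mktuple.
by case: (unliftP ord0 i) => [j|] -> //=; rewrite !tnthS tnth_mktuple.
Qed.

(** Step k trades the value of the k-th coordinate for an integral over it.
    In the induction on n the first coordinate y is integrated last: for each
    fixed y the shifted family u |-> F k.+1 (y :: u) satisfies the hypotheses
    in dimension n, and Tonelli's theorem recombines the integrals. *)
Lemma iterated_line_bound n (F : nat -> T n -> \bar R) :
  (forall k t, 0 <= F k t) -> (forall k, measurable_fun setT (F k)) ->
  (forall k t, (k < n)%N ->
    F k t <= 2%:E * \int[mu]_y F k.+1 (tupd t k y)) ->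
  forall t, F 0%N t <= (2 ^+ n)%:E * \int[lebesgue_tuple R n]_u F n u.
Proof.
elim: n F => [|n IH] F F0 mF step t.
  by rewrite expr0 mul1e integral_tuple0// (tuple0 t).
rewrite -(tunconsK t); case: (tuncons t) => x t' {t}.
apply: (le_trans (step 0%N _ isT)).
under eq_integral do rewrite tupd0.
rewrite integral_tupleS// exprS EFinM -muleA lee_pmul2l//.
rewrite -ge0_integralZl//; last 2 first.
- exact: measurable_integral_tcons.
- by move=> y _; exact: integral_ge0.
have mI : measurable_fun setT
    (fun y => \int[lebesgue_tuple R n]_u F n.+1 (tcons (y, u))).
  exact: measurable_integral_tcons.
apply: ge0_le_integral => //.
- exact: measurable_tcons_left.
- exact: measurable_funeM.
move=> y _; apply: (IH (fun k u => F k.+1 (tcons (y, u)))) => //.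
- by move=> k; exact: measurable_tcons_right.
move=> k u kn; have := step k.+1 (tcons (y, u)) kn.
by under eq_integral do rewrite tupdS.
Qed.

End tuple_integral.

(** * The Sobolev inequality on the line *)

Section line_estimate.
Context {R : realType}.
Local Notation mu := (@lebesgue_measure R).
Variables h dh : R -> R.
Hypothesis h_dh : forall x : R, is_derive x 1 h (dh x).
Hypothesis continuous_dh : continuous dh.

Let continuous_h : continuous h.
Proof.
move=> x; apply: differentiable_continuous; apply/derivable1_diffP.
by have [] := h_dh x.
Qed.

(** The left-hand side is the increment over [a, a + 1] of F(y) = (y - c) h(y)^2,
    and F' = h^2 + 2 (y - c) h h' <= 2 (h^2 + h'^2) because |y - c| <= 1. Only
    c = a and c = a + 1 matter below: they give the values of h at the right
    and the left end. *)
Lemma unit_interval_estimate (a c : R) : a <= c <= a + 1 ->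
  (((a + 1 - c) * h (a + 1) ^+ 2 + (c - a) * h a ^+ 2)%R%:E <=
  2%:E * \int[mu]_(y in `[a, (a + 1)%R]) (h y ^+ 2 + dh y ^+ 2)%R%:E)%E.
Proof.
move=> /andP[ac ca].
pose F y := (y - c) * (h y * h y).
pose f y := h y * h y + (y - c) * (h y * dh y + h y * dh y).
have Ff (y : R) : is_derive y 1 F (f y).
  have d1 : is_derive y 1 (fun y : R => y - c) 1.
    by apply: is_derive_eq; rewrite subr0.
  have d2 := is_deriveM (h_dh y) (h_dh y).
  apply: is_derive_eq (is_deriveM d1 d2) _.
  transitivity ((y - c) * (h y * dh y + h y * dh y) + h y * h y * 1); first by [].
  by rewrite mulr1 addrC.
have cF : continuous F.
  move=> y; apply: differentiable_continuous; apply/derivable1_diffP.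
  by have [] := Ff y.
have cf : continuous f.
  have cM (u v : R -> R) : continuous u -> continuous v ->
      continuous (fun y => u y * v y).
    by move=> cu cv y; apply: cvgM; [exact: cu|exact: cv].
  move=> y; apply: cvgD; first exact: cM.
  apply: cvgM; first by apply: cvgB; [exact: cvg_id|exact: cvg_cst].
  by apply: cvgD; exact: cM.
have cq : continuous (fun y => h y ^+ 2 + dh y ^+ 2).
  by move=> y; apply: cvgD; apply: cvgM;
    (exact: continuous_h || exact: continuous_dh).
have a1 : a < a + 1 by rewrite ltrDl.
have := @continuous_FTC2 R f F a (a + 1) a1 (continuous_subspaceT cf).
move=> /(_ _ _) E.
rewrite [leLHS](_ : _ = ((F (a + 1)%R)%:E - (F a)%:E)%E); last first.
  by rewrite -EFinB /F; congr (_%:E); ring.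
rewrite -E; last 2 first.
- split=> [y _||]; first by have [] := Ff y.
  + by apply: cvg_at_right_filter; exact: cF.
  + by apply: cvg_at_left_filter; exact: cF.
- by move=> y _; rewrite derive1E; have [_] := Ff y.
have mI : measurable (`[a, a + 1] : set R) by exact: measurable_itv.
have mq : measurable_fun setT (fun y => h y ^+ 2 + dh y ^+ 2).
  exact: continuous_measurable_fun.
rewrite -ge0_integralZl//; last 2 first.
- by apply/measurable_EFinP; exact: measurable_funTS.
- by move=> y _; rewrite lee_fin addr_ge0 ?sqr_ge0.
apply: le_integral => //.
- apply: continuous_compact_integrable; first exact: segment_compact.
  exact: continuous_subspaceT.
- rewrite (_ : (fun y => _) = EFin \o (fun y => 2 * (h y ^+ 2 + dh y ^+ 2))); last first.
    by apply/funext => y /=; rewrite EFinM.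
  apply: continuous_compact_integrable; first exact: segment_compact.
  by apply: continuous_subspaceT => y; apply: cvgM; [exact: cvg_cst|exact: cq].
move=> y; rewrite inE /= in_itv /= => /andP[ay ya].
rewrite -EFinM lee_fin /f.
have : `|y - c| <= 1 by rewrite ler_norml; apply/andP; split; lra.
rewrite ler_norml => /andP[l1 l2].
have : (y - c) * (2 * h y * dh y) <= h y ^+ 2 + dh y ^+ 2.
  have : 0 <= (h y - dh y) ^+ 2 by exact: sqr_ge0.
  have : 0 <= (h y + dh y) ^+ 2 by exact: sqr_ge0.
  by nra.
have := sqr_ge0 (dh y).
by nra.
Qed.

(** The square of w is nondecreasing in |y|, so it suffices to integrate over the
    unit interval starting at x and pointing away from the origin. *)
Lemma weighted_line_estimate (w : R -> R) (x : R) : continuous w ->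
  (forall y z, `|y| <= `|z| -> w y ^+ 2 <= w z ^+ 2) ->
  (((w x * h x) ^+ 2)%R%:E <=
  2%:E * \int[mu]_y ((w y * h y) ^+ 2 + (w y * dh y) ^+ 2)%R%:E)%E.
Proof.
move=> cw w_mono.
suff [a [xa aw hx]] : exists a : R, [/\ x \in `[a, a + 1],
    {in `[a, a + 1], forall y, `|x| <= `|y| } &
    ((h x ^+ 2)%R%:E <=
      2%:E * \int[mu]_(y in `[a, (a + 1)%R]) (h y ^+ 2 + dh y ^+ 2)%R%:E)%E].
  have cq : continuous (fun y => (w y * h y) ^+ 2 + (w y * dh y) ^+ 2).
    by move=> y; apply: cvgD; apply: cvgM; apply: cvgM;
      (exact: cw || exact: continuous_h || exact: continuous_dh).
  have mq : measurable_fun setT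
      (fun y => (w y * h y) ^+ 2 + (w y * dh y) ^+ 2).
    exact: continuous_measurable_fun.
  have cp : continuous (fun y => h y ^+ 2 + dh y ^+ 2).
    by move=> y; apply: cvgD; apply: cvgM;
      (exact: continuous_h || exact: continuous_dh).
  have mp : measurable_fun `[a, a + 1]%classic (fun y => h y ^+ 2 + dh y ^+ 2).
    by apply: measurable_funTS; exact: continuous_measurable_fun.
  rewrite exprMn EFinM.
  apply: (@le_trans _ _ ((w x ^+ 2)%R%:E *
     (2%:E * \int[mu]_(y in `[a, (a + 1)%R])
        (h y ^+ 2 + dh y ^+ 2)%R%:E))%E).
    by apply: lee_wpmul2l => //; rewrite lee_fin sqr_ge0.
  rewrite muleCA lee_pmul2l// -ge0_integralZl//; last 3 first.
  - exact/measurable_EFinP.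
  - by move=> y _; rewrite lee_fin addr_ge0 ?sqr_ge0.
  - by rewrite lee_fin sqr_ge0.
  apply: (@le_trans _ _ (\int[mu]_(y in `[a, (a + 1)%R])
      ((w y * h y) ^+ 2 + (w y * dh y) ^+ 2)%R%:E)%E).
    apply: ge0_le_integral => //.
    - by move=> y _; rewrite mule_ge0// lee_fin ?addr_ge0 ?sqr_ge0.
    - by apply: measurable_funeM; exact/measurable_EFinP.
    - by apply/measurable_EFinP; exact: measurable_funTS.
    move=> y ya; rewrite -EFinM lee_fin !exprMn -mulrDr ler_wpM2r//.
      by rewrite addr_ge0 ?sqr_ge0.
    by apply: w_mono; exact: aw.
  apply: ge0_subset_integral => //; first exact/measurable_EFinP.
  by move=> y _; rewrite lee_fin addr_ge0 ?sqr_ge0.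
have [x0|x0] := leP 0 x.
  exists x; split; first by rewrite in_itv /= lexx lerDl ler01.
    move=> y; rewrite in_itv /= => /andP[xy _].
    by rewrite !ger0_norm// (le_trans x0).
  have := @unit_interval_estimate x (x + 1).
  rewrite lexx lerDl ler01 subrr mul0r add0r addrAC subrr add0r mul1r.
  exact.
exists (x - 1); split; first by rewrite in_itv /= subrK lexx lerBlDr lerDl ler01.
  move=> y; rewrite in_itv /= subrK => /andP[_ yx].
  by rewrite !ler0_norm ?lerN2// ?(le_trans yx)// ltW.
have := @unit_interval_estimate (x - 1) (x - 1).
rewrite lexx lerDl ler01 subrr mul0r addr0 subrK opprB addrCA subrr addr0 mul1r.
exact.
Qed.

End line_estimate.

(** * The Sobolev inequality in dimension n *)

Section iterated_estimate.
Context {R : realType} {n : nat}.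
Local Notation mu := (@lebesgue_measure R).
Local Notation T := (n.-tuple (measurableTypeR R)).
Implicit Types (f : 'rV[R]_n -> R) (s : seq 'I_n) (t : T) (i : 'I_n).
Variable a : 'I_n -> nat.

Lemma row_tupd t i (y : R) :
  row_of_tuple (tupd t i y) = row_of_tuple (tupd t i 0) + y *: delta_mx 0 i.
Proof.
apply/rowP => j; rewrite !mxE !tnth_mktuple eqxx/= -(inj_eq val_inj).
by case: eqP => _; rewrite ?add0r ?mulr1// mulr0 addr0.
Qed.

Lemma row_tupd_id t i : row_of_tuple (tupd t i (tnth t i)) = row_of_tuple t.
Proof.
apply/rowP => j; rewrite !mxE !tnth_mktuple.
by case: eqP => // /val_inj ->.
Qed.

Lemma continuous_row_tupd f t i : continuous f ->
  continuous (fun y : R => f (row_of_tuple (tupd t i y))).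
Proof.
move=> cf y; under eq_fun do rewrite row_tupd.
by apply: continuous_comp; [exact: continuous_line|exact: cf].
Qed.

Lemma is_derive_row_tupd f t i (y : R) : smooth_real f ->
  is_derive y 1 (fun y : R => f (row_of_tuple (tupd t i y)))
    (partial i f (row_of_tuple (tupd t i y))).
Proof.
move=> sf; rewrite (row_tupd t i y); under eq_fun do rewrite row_tupd.
by apply: is_derive_line; exact: (sf [::]).2.
Qed.

(** The sum of (x^a D^g f)^2 over all subsequences g of s: each direction in s
    is either skipped or differentiated once. The recursion makes both the
    passage from s to [rcons s i] and the final summation plain inductions. *)
Fixpoint energy s f : 'rV[R]_n -> R :=
  if s is i :: s' then energy s' f \+ energy s' (partial i f)
  else fun x => (monomial a x * f x) ^+ 2.

Lemma energy_ge0 s f x : 0 <= energy s f x.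
Proof.
by elim: s f => [|i s IH] f /=; [exact: sqr_ge0|rewrite addr_ge0].
Qed.

Lemma monomial_row_tupd t i (y : R) : monomial a (row_of_tuple (tupd t i y)) =
  (\prod_(j < n | j != i) tnth t j ^+ a j) * y ^+ a i.
Proof.
rewrite /monomial (bigD1 i)//= mulrC; congr (_ * _).
  apply: eq_bigr => j ji; rewrite mxE tnth_mktuple (inj_eq val_inj).
  by rewrite (negbTE ji).
by rewrite mxE tnth_mktuple eqxx.
Qed.

Lemma continuous_monomial : continuous (monomial a : 'rV[R]_n -> R).
Proof.
rewrite /monomial; elim: (index_enum _) => [|i s IH].
  rewrite [X in continuous X](_ : _ = cst 1); first exact: cst_continuous.
  by apply/funext => x; rewrite big_nil.
rewrite [X in continuous X](_ : _ =
    (fun x : 'rV[R]_n => x 0 i ^+ a i * \prod_(j <- s) x 0 j ^+ a j)); last first.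
  by apply/funext => x; rewrite big_cons.
have ci : continuous (fun x : 'rV[R]_n => x 0 i ^+ a i).
  move=> x; apply: (@continuous_comp _ _ _ (fun x : 'rV[R]_n => x 0 i)
    (fun u : R => u ^+ a i)); first exact: coord_continuous.
  exact: exprn_continuous.
move=> x; exact: (cvgM (ci x) (IH x)).
Qed.

Lemma continuous_energy s f : smooth_real f -> continuous (energy s f).
Proof.
elim: s f => [|i s IH] f sf x /=.
  have cf : continuous f by have [] := sf [::].
  have cmf : {for x, continuous (fun x => monomial a x * f x)}.
    exact: (cvgM (@continuous_monomial x) (cf x)).
  exact: (cvgM cmf cmf).
exact: (cvgD (IH f sf x) (IH _ (smooth_real_partial i sf) x)).
Qed.

(** The inequality on the line, applied along the i-th axis to each term of the
    energy, produces exactly the terms of the energy with i added. *)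
Lemma energy_line s f t i : smooth_real f ->
  ((energy s f (row_of_tuple t))%:E <=
  2%:E * \int[mu]_y (energy (rcons s i) f (row_of_tuple (tupd t i y)))%:E)%E.
Proof.
elim: s f => [|j s IH] f sf /=.
  have := @weighted_line_estimate R (fun y => f (row_of_tuple (tupd t i y)))
    (fun y => partial i f (row_of_tuple (tupd t i y))) _ _
    (fun y => monomial a (row_of_tuple (tupd t i y))) (tnth t i).
  rewrite /= row_tupd_id; apply.
  - by move=> y; exact: is_derive_row_tupd.
  - by apply: continuous_row_tupd; have [] := sf [:: i].
  - by apply: continuous_row_tupd; exact: continuous_monomial.
  - move=> y z yz; rewrite !monomial_row_tupd !exprMn ler_wpM2l ?sqr_ge0//.
    rewrite -!exprM !(mulnC (a i)) !exprM lerXn2r ?nnegrE ?sqr_ge0//.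
    by rewrite -(real_normK (num_real y)) -(real_normK (num_real z)) lerXn2r ?nnegrE.
have sjf := smooth_real_partial j sf.
have mE g : smooth_real g ->
    measurable_fun setT
      (fun y => energy (rcons s i) g (row_of_tuple (tupd t i y))).
  move=> sg; apply: continuous_measurable_fun; apply: continuous_row_tupd.
  exact: continuous_energy.
under eq_integral do rewrite EFinD.
rewrite ge0_integralD//; last 4 first.
- by move=> y _; rewrite lee_fin energy_ge0.
- by apply/measurable_EFinP; exact: mE.
- by move=> y _; rewrite lee_fin energy_ge0.
- by apply/measurable_EFinP; exact: mE.
rewrite ge0_muleDr ?integral_ge0//; last 2 first.
- by move=> y _; rewrite lee_fin energy_ge0.
- by move=> y _; rewrite lee_fin energy_ge0.
by rewrite EFinD leeD// IH.
Qed.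

Lemma measurable_energy s f : smooth_real f ->
  measurable_fun [set: T] (fun t => (energy s f (row_of_tuple t))%:E).
Proof.
move=> sf; apply/measurable_EFinP; apply: measurable_row_continuous.
exact: continuous_energy.
Qed.

(** The energies along the prefixes of the enumeration of the coordinates
    interpolate between (x^a f)^2 and the full energy; consecutive ones are
    related by the estimate on a line. *)
Lemma pointwise_le_energy f t : smooth_real f ->
  (((monomial a (row_of_tuple t) * f (row_of_tuple t)) ^+ 2)%R%:E <=
  (2 ^+ n)%R%:E *
    \int[lebesgue_tuple R n]_u (energy (enum 'I_n) f (row_of_tuple u))%:E)%E.
Proof.
move=> sf.
have := @iterated_line_bound R n
  (fun k u => (energy (take k (enum 'I_n)) f (row_of_tuple u))%:E).
have enumE : take n (enum 'I_n) = enum 'I_n.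
  by rewrite take_oversize// size_enum_ord.
move=> /(_ _ _ _ t); rewrite take0 enumE; apply.
- by move=> k u; rewrite lee_fin energy_ge0.
- by move=> k; exact: measurable_energy.
move=> k u kn; pose i := Ordinal kn.
rewrite (take_nth i) ?size_enum_ord// (_ : nth i _ _ = i); last first.
  by apply: val_inj; rewrite /= nth_enum_ord.
exact: (energy_line _ _ i).
Qed.

Lemma integral_energy_le s f (K : R) : smooth_real f ->
  (forall s', (size s' <= size s)%N ->
    (\int[lebesgue_tuple R n]_u
      ((monomial a (row_of_tuple u) * partials s' f (row_of_tuple u)) ^+ 2)%R%:E
     <= K%:E)%E) ->
  (\int[lebesgue_tuple R n]_u (energy s f (row_of_tuple u))%:E
    <= (2 ^+ size s * K)%R%:E)%E.
Proof.
elim: s f => [|i s IH] f sf H /=.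
  by rewrite expr0 mul1r; exact: (H [::]).
have sif := smooth_real_partial i sf.
under eq_integral do rewrite EFinD.
rewrite ge0_integralD//; last 4 first.
- by move=> y _; rewrite lee_fin energy_ge0.
- exact: measurable_energy.
- by move=> y _; rewrite lee_fin energy_ge0.
- exact: measurable_energy.
rewrite exprS -mulrA mulr_natl mulr2n EFinD; apply: leeD; apply: IH => // s' ss'.
  by apply: H; rewrite (leq_trans ss').
by rewrite -(partials_cat s' [:: i]); apply: H; rewrite size_cat addn1.
Qed.

End iterated_estimate.

(** * From L2 bounds to sup bounds *)

Section norms.
Context {R : realType} {n : nat}.
Local Notation T := (n.-tuple (measurableTypeR R)).
Local Notation N := (@Normc.normc R).
Implicit Types (phi : 'rV[R]_n -> R[i]) (a b : 'I_n -> nat).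

Lemma sup_norm_leP phi (K : R) :
  (sup_norm phi <= K%:E)%E <-> forall x, N (phi x) <= K.
Proof.
split=> [le_K x|le_K].
  rewrite -lee_fin; apply: le_trans le_K.
  by apply: ereal_sup_ubound; exists x.
by apply: ge_ereal_sup => _ [x _ <-]; rewrite lee_fin.
Qed.

Lemma L2_norm_leP phi (K : R) : 0 <= K ->
  (L2_norm phi <= K%:E)%E <->
  (\int[lebesgue_tuple R n]_t (N (phi (row_of_tuple t)) ^+ 2)%R%:E
    <= (K ^+ 2)%R%:E)%E.
Proof.
move=> K0; set I := (\int[_]_t _)%E.
have L2 : (L2_norm phi `^ 2)%E = I.
  rewrite /L2_norm poweR_Lnorm ?pnatr_eq0//; apply: eq_integral => t _.
  by rewrite poweR_EFin powR_mulrn// real_normK ?num_real.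
have L0 : (0 <= L2_norm phi)%E by exact: Lnorm_ge0.
have I0 : (0 <= I)%E by rewrite -L2 poweR_ge0.
have pos (x : \bar R) : (0 <= x)%E -> x \in `[0%E, +oo%E].
  by rewrite in_itv /= leey andbT.
split=> H.
  rewrite -L2 -(powR_mulrn 2 K0) -poweR_EFin.
  by apply: gt0_ler_poweR => //; apply: pos; rewrite ?lee_fin.
have -> : L2_norm phi = (I `^ 2^-1)%E.
  by rewrite -L2 -poweRrM mulfV ?pnatr_eq0// poweRe1.
have -> : K%:E = ((K ^+ 2)%R%:E `^ 2^-1)%E.
  rewrite -(powR_mulrn 2 K0) -poweR_EFin -poweRrM mulfV ?pnatr_eq0//.
  by rewrite poweRe1// lee_fin.
by apply: gt0_ler_poweR => //; apply: pos => //; rewrite lee_fin sqr_ge0.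
Qed.

Lemma normc_weighted a b phi x :
  N (weighted_deriv a b phi x) ^+ 2 =
  (monomial a x * mderiv_real b (fun y => complex.Re (phi y)) x) ^+ 2 +
  (monomial a x * mderiv_real b (fun y => complex.Im (phi y)) x) ^+ 2.
Proof.
rewrite /weighted_deriv /mderiv /Normc.normc /=.
by rewrite sqr_sqrtr ?addr_ge0 ?sqr_ge0// !mul0r subr0 addr0.
Qed.

Lemma smooth_real_mderiv b (f : 'rV[R]_n -> R) :
  smooth_real f -> smooth_real (mderiv_real b f).
Proof. by move=> sf; rewrite mderiv_realE; exact: smooth_real_partials. Qed.

Lemma measurable_sqr_weighted a b (f : 'rV[R]_n -> R) : smooth_real f ->
  measurable_fun [set: T]
    (fun t => ((monomial a (row_of_tuple t) *
      mderiv_real b f (row_of_tuple t)) ^+ 2)%:E).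
Proof.
by move=> sf; apply: (measurable_energy a [::]); exact: smooth_real_mderiv.
Qed.

Lemma measurable_normc_weighted a b phi : smooth phi ->
  measurable_fun [set: T]
    (fun t => (N (weighted_deriv a b phi (row_of_tuple t)) ^+ 2)%:E).
Proof.
move=> [sRe sIm]; under eq_fun do rewrite normc_weighted EFinD.
by apply: emeasurable_funD; exact: measurable_sqr_weighted.
Qed.

(** The energy of D^b f along all coordinates involves derivatives of f of
    order at most |b| + n only, and there are 2^n of them; the other factor
    2^n comes from the n integrations along lines. *)
Lemma sobolev_real a b (f : 'rV[R]_n -> R) (K : R) t : smooth_real f ->
  (forall b', (mdegree b' <= mdegree b + n)%N ->
    (\int[lebesgue_tuple R n]_u ((monomial a (row_of_tuple u) *
        mderiv_real b' f (row_of_tuple u)) ^+ 2)%R%:E <= (K ^+ 2)%R%:E)%E) ->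
  (monomial a (row_of_tuple t) * mderiv_real b f (row_of_tuple t)) ^+ 2 <=
    2 ^+ n * (2 ^+ n * K ^+ 2).
Proof.
move=> sf H; rewrite -lee_fin.
apply: (le_trans (pointwise_le_energy _ _ (smooth_real_mderiv b sf))).
rewrite EFinM lee_pmul2l ?lte_fin ?exprn_gt0//.
have := @integral_energy_le R n a (enum 'I_n) (mderiv_real b f) (K ^+ 2).
rewrite size_enum_ord; apply; first exact: smooth_real_mderiv.
move=> s sn; rewrite mderiv_realE -partials_cat partialsE//; apply: H.
by rewrite mdegree_count size_cat size_mderiv_seq addnC leq_add2l.
Qed.

Lemma sup_norm_le_L2 a b phi (K : R) : smooth phi -> 0 <= K ->
  (forall b', (mdegree b' <= mdegree b + n)%N ->
    (L2_norm (weighted_deriv a b' phi) <= K%:E)%E) ->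
  (sup_norm (weighted_deriv a b phi) <= (2 ^+ n.+1 * K)%R%:E)%E.
Proof.
move=> sphi K0 H; apply/sup_norm_leP => x; have [sRe sIm] := sphi.
pose t : T := [tuple x 0 i | i < n].
have -> : x = row_of_tuple t by apply/rowP => i; rewrite mxE tnth_mktuple.
have H2 b' : (mdegree b' <= mdegree b + n)%N ->
    (\int[lebesgue_tuple R n]_u
      (N (weighted_deriv a b' phi (row_of_tuple u)) ^+ 2)%R%:E
     <= (K ^+ 2)%R%:E)%E.
  by move=> /H /L2_norm_leP; apply.
have HRe : (monomial a (row_of_tuple t) *
    mderiv_real b (fun y => complex.Re (phi y)) (row_of_tuple t)) ^+ 2 <=
    2 ^+ n * (2 ^+ n * K ^+ 2).
  apply: sobolev_real => // b' /H2; apply: le_trans; apply: ge0_le_integral => //.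
  - by move=> u _; rewrite lee_fin sqr_ge0.
  - exact: measurable_sqr_weighted.
  - exact: measurable_normc_weighted.
  - by move=> u _; rewrite lee_fin normc_weighted lerDl sqr_ge0.
have HIm : (monomial a (row_of_tuple t) *
    mderiv_real b (fun y => complex.Im (phi y)) (row_of_tuple t)) ^+ 2 <=
    2 ^+ n * (2 ^+ n * K ^+ 2).
  apply: sobolev_real => // b' /H2; apply: le_trans; apply: ge0_le_integral => //.
  - by move=> u _; rewrite lee_fin sqr_ge0.
  - exact: measurable_sqr_weighted.
  - exact: measurable_normc_weighted.
  - by move=> u _; rewrite lee_fin normc_weighted lerDr sqr_ge0.
have C0 : 0 <= 2 ^+ n * K by rewrite mulr_ge0 ?exprn_ge0.
have norm0 : 0 <= N (weighted_deriv a b phi (row_of_tuple t)).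
  by case: (weighted_deriv _ _ _ _) => u v; exact: sqrtr_ge0.
rewrite exprS -mulrA -ler_sqr ?nnegrE//; last by rewrite mulr_ge0.
rewrite normc_weighted.
set A := (_ * _) ^+ 2 in HRe *; set B := (_ * _) ^+ 2 in HIm *.
(* A + B <= 2 (2^n K)^2 <= (2 (2^n K))^2 *)
have := sqr_ge0 (2 ^+ n * K).
nra.
Qed.

End norms.

(** * From sup bounds to L2 bounds *)

Section lorentzian.
Context {R : realType}.
Local Notation mu := (@lebesgue_measure R).
Local Open Scope ereal_scope.

Lemma oneDsqrV_ge0 (x : R) : (0 <= (oneDsqr x)^-1)%R.
Proof. by rewrite invr_ge0 addr_ge0 ?sqr_ge0. Qed.

Lemma integral_oneDsqrV : \int[mu]_x ((oneDsqr x)^-1)%:E = (pi : R)%:E.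
Proof.
rewrite ge0_symfun_integralT.
- rewrite (_ : [set x : R | _] = `[0%R, +oo[%classic); last first.
    by apply/seteqP; split => x /=; rewrite in_itv /= andbT.
  by rewrite integral0y_oneDsqr -EFinM mulrCA divff ?pnatr_eq0// mulr1.
- exact: oneDsqrV_ge0.
- exact: continuous_oneDsqrV.
- by move=> x; rewrite /= /oneDsqr sqrrN.
Qed.

Lemma measurable_prod_oneDsqrV n : measurable_fun setT
  (fun t : n.-tuple (measurableTypeR R) =>
    (\prod_(i < n) (oneDsqr (tnth t i))^-1)%R%:E).
Proof.
apply/measurable_EFinP; apply: measurable_prod => i _.
apply: (@measurableT_comp _ _ _ _ _ _ (fun x : R => (oneDsqr x)^-1)%R).
  by apply: continuous_measurable_fun; exact: continuous_oneDsqrV.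
exact: measurable_tnth.
Qed.

Lemma integral_prod_oneDsqrV n :
  \int[lebesgue_tuple R n]_t (\prod_(i < n) (oneDsqr (tnth t i))^-1)%R%:E =
  (pi ^+ n)%R%:E.
Proof.
elim: n => [|n IH].
  by rewrite integral_tuple0 ?big_ord0//; exact: measurable_prod_oneDsqrV.
have P0 m (t : m.-tuple (measurableTypeR R)) :
    (0 <= \prod_(i < m) (oneDsqr (tnth t i))^-1)%R.
  by apply: prodr_ge0 => i _; exact: oneDsqrV_ge0.
rewrite integral_tupleS; last 2 first.
- exact: measurable_prod_oneDsqrV.
- by move=> t; rewrite lee_fin; exact: P0.
transitivity (\int[mu]_x ((pi ^+ n)%R%:E * ((oneDsqr x)^-1)%R%:E)).
  apply: eq_integral => x _; rewrite -IH muleC -ge0_integralZl//; last 2 first.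
  - exact: measurable_prod_oneDsqrV.
  - by move=> t _; rewrite lee_fin; exact: P0.
  apply: eq_integral => t _; rewrite big_ord_recl EFinM; congr (_%:E * _%:E).
  by apply: eq_bigr => i _; rewrite tnthS.
have mq : measurable_fun setT (fun x : measurableTypeR R => ((oneDsqr x)^-1)%:E).
  apply/measurable_EFinP; apply: continuous_measurable_fun.
  exact: continuous_oneDsqrV.
have pi_n : 0 <= (pi ^+ n)%R%:E :> \bar R by rewrite lee_fin exprn_ge0// pi_ge0.
rewrite (ge0_integralZl _ _ mq)//.
by rewrite integral_oneDsqrV -EFinM exprSr.
Qed.

End lorentzian.

Section decay.
Context {R : realType} {n : nat}.
Local Notation T := (n.-tuple (measurableTypeR R)).
Local Notation N := (@Normc.normc R).
Implicit Types (phi : 'rV[R]_n -> R[i]) (a b : 'I_n -> nat).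

(** The exponent a' depends on the point: it exceeds a by one in the coordinates
    with |x_i| > 1, where 1 + x_i^2 <= 2 x_i^2; in the others 1 + x_i^2 <= 2. A
    pointwise choice avoids expanding the product of the 1 + x_i^2. *)
Lemma monomial_oneDsqr a (x : 'rV[R]_n) : exists2 a',
  (mdegree a' <= mdegree a + n)%N &
  monomial a x ^+ 2 * \prod_i oneDsqr (x 0 i) <= 2 ^+ n * monomial a' x ^+ 2.
Proof.
exists (fun i => a i + (1 < x 0 i ^+ 2)%R)%N.
  rewrite /mdegree big_split /= leq_add2l -[leqRHS]card_ord -sum1_card.
  by apply: leq_sum => i _; case: (_ < _)%R.
have -> : 2 ^+ n = \prod_(i < n) 2 :> R by rewrite prodr_const card_ord.
rewrite /monomial -!prodrXl -!big_split /=; apply: ler_prod => i _.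
have x0 := sqr_ge0 (x 0 i).
apply/andP; split; first by rewrite mulr_ge0 ?sqr_ge0 ?addr_ge0.
rewrite exprD exprMn mulrCA ler_wpM2l ?sqr_ge0//.
rewrite /oneDsqr; case: ltP => h; rewrite ?expr1 ?expr0; first lra.
by rewrite expr1n; lra.
Qed.

Lemma L2_norm_le_sup a b phi (K : R) : smooth phi -> 0 <= K ->
  (forall a', (mdegree a' <= mdegree a + n)%N ->
    (sup_norm (weighted_deriv a' b phi) <= K%:E)%E) ->
  (L2_norm (weighted_deriv a b phi) <= ((2 * pi) ^+ n * K)%R%:E)%E.
Proof.
move=> sphi K0 H.
have pi2 : 1 <= 2 * pi :> R by have := pi_ge2 R; lra.
have C1 : 1 <= (2 * pi) ^+ n :> R by rewrite exprn_ege1.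
apply/L2_norm_leP; first by rewrite mulr_ge0// (le_trans ler01).
have decay (x : 'rV[R]_n) : N (weighted_deriv a b phi x) ^+ 2 <=
    2 ^+ n * K ^+ 2 * \prod_i (oneDsqr (x 0 i))^-1.
  have [a' a'n le_a'] := monomial_oneDsqr a x.
  have /sup_norm_leP/(_ x) {}H := H a' a'n.
  have P0 : 0 < \prod_i oneDsqr (x 0 i).
    by apply: prodr_gt0 => i _; rewrite ltr_pwDl ?sqr_ge0.
  rewrite prodfV ler_pdivlMr//.
  have Nw c : N (weighted_deriv c b phi x) ^+ 2 =
      monomial c x ^+ 2 * N (mderiv b phi x) ^+ 2.
    rewrite /weighted_deriv Normc.normcM exprMn /Normc.normc /= expr0n addr0.
    by rewrite sqrtr_sqr real_normK ?num_real.
  rewrite Nw mulrAC.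
  apply: (@le_trans _ _
    (2 ^+ n * monomial a' x ^+ 2 * N (mderiv b phi x) ^+ 2)).
    by rewrite ler_wpM2r ?sqr_ge0.
  rewrite -mulrA -Nw ler_wpM2l ?exprn_ge0// ler_sqr ?nnegrE//.
  by case: (weighted_deriv _ _ _ _) => u v; exact: sqrtr_ge0.
have P0 (t : T) : 0 <= \prod_i (oneDsqr (tnth t i))^-1.
  by apply: prodr_ge0 => i _; exact: oneDsqrV_ge0.
apply: (@le_trans _ _ (\int[lebesgue_tuple R n]_t ((2 ^+ n * K ^+ 2)%R%:E *
    (\prod_i (oneDsqr (tnth t i))^-1)%R%:E))%E).
  apply: ge0_le_integral => //.
  - by move=> t _; rewrite lee_fin sqr_ge0.
  - exact: measurable_normc_weighted.
  - by apply: measurable_funeM; exact: measurable_prod_oneDsqrV.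
  move=> t _; rewrite -EFinM lee_fin; apply: le_trans (decay _) _.
  by under eq_bigr do rewrite mxE.
rewrite ge0_integralZl//; last 3 first.
- exact: measurable_prod_oneDsqrV.
- by move=> t _; rewrite lee_fin; exact: P0.
- by rewrite lee_fin mulr_ge0 ?exprn_ge0 ?sqr_ge0.
rewrite integral_prod_oneDsqrV -EFinM lee_fin mulrAC -[2 ^+ n * pi ^+ n]exprMn.
rewrite [leRHS]exprMn ler_wpM2r ?sqr_ge0//.
(* (2 pi)^n <= ((2 pi)^n)^2, since 2 pi >= 1 *)
by rewrite ler_eXnr.
Qed.

End decay.

(** * Comparison of the spaces *)

Section transfer.
Context {R : realType} {n : nat}.
Variable (sigma : R).
Hypothesis sigma_gt1 : 1 < sigma.
Implicit Types (phi : 'rV[R]_n -> R[i]).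

Lemma seminorm_bounds_L2_sup (tau C : R) phi : 0 < tau -> 0 < C -> smooth phi ->
  seminorm_bounds sigma L2_norm tau C phi ->
  exists2 C', 0 < C' &
    seminorm_bounds sigma sup_norm (2 `^ (sigma + 1) * tau) C' phi.
Proof.
move=> t0 C0 sphi H; have [D D1 HD] := Mseq_shift n t0 sigma_gt1.
have D0 : 0 < D by rewrite (lt_le_trans ltr01).
exists (2 ^+ n.+1 * (C * D * D)); first by rewrite !mulr_gt0 ?exprn_gt0.
move=> a b; set tau' := _ * tau.
rewrite (_ : _ * _ = 2 ^+ n.+1 *
  (C * (D * Mseq tau' sigma (mdegree a)) *
    (D * Mseq tau' sigma (mdegree b)))); last by ring.
apply: sup_norm_le_L2 => // [|b' b'n].
  by rewrite !mulr_ge0 ?(ltW (Mseq_gt0 _ _ _)) ?ltW.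
apply: le_trans (H a b') _; rewrite lee_fin.
apply: ler_pM; rewrite ?mulr_ge0 ?(ltW (Mseq_gt0 _ _ _)) ?(ltW C0)//; last exact: HD.
by rewrite ler_wpM2l ?(ltW C0)// HD// leq_addr.
Qed.

Lemma seminorm_bounds_sup_L2 (tau C : R) phi : 0 < tau -> 0 < C -> smooth phi ->
  seminorm_bounds sigma sup_norm tau C phi ->
  exists2 C', 0 < C' &
    seminorm_bounds sigma L2_norm (2 `^ (sigma + 1) * tau) C' phi.
Proof.
move=> t0 C0 sphi H; have [D D1 HD] := Mseq_shift n t0 sigma_gt1.
have D0 : 0 < D by rewrite (lt_le_trans ltr01).
have pi0 : 0 < 2 * pi :> R by rewrite mulr_gt0// pi_gt0.
exists ((2 * pi) ^+ n * (C * D * D)); first by rewrite !mulr_gt0 ?exprn_gt0.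
move=> a b; set tau' := _ * tau.
rewrite (_ : _ * _ = (2 * pi) ^+ n *
  (C * (D * Mseq tau' sigma (mdegree a)) *
    (D * Mseq tau' sigma (mdegree b)))); last by ring.
apply: L2_norm_le_sup => // [|a' a'n].
  by rewrite !mulr_ge0 ?(ltW (Mseq_gt0 _ _ _)) ?ltW.
apply: le_trans (H a' b) _; rewrite lee_fin.
apply: ler_pM; rewrite ?mulr_ge0 ?(ltW (Mseq_gt0 _ _ _)) ?(ltW C0)//.
  by rewrite ler_wpM2l ?(ltW C0)// HD.
by rewrite HD// leq_addr.
Qed.

(** In the Roumieu case tau is replaced by c tau; in the Beurling case the
    hypothesis is used at tau / c. *)
Lemma Roumieu_transfer (N1 N2 : ('rV[R]_n -> R[i]) -> \bar R) (c : R) phi :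
  0 < c ->
  (forall tau C, 0 < tau -> 0 < C -> seminorm_bounds sigma N1 tau C phi ->
    exists2 C', 0 < C' & seminorm_bounds sigma N2 (c * tau) C' phi) ->
  (exists2 tau, 0 < tau &
    exists2 C, 0 < C & seminorm_bounds sigma N1 tau C phi) ->
  exists2 tau, 0 < tau & exists2 C, 0 < C & seminorm_bounds sigma N2 tau C phi.
Proof.
move=> c0 H [tau t0 [C C0 HC]].
by exists (c * tau); [exact: mulr_gt0|exact: H HC].
Qed.

Lemma Beurling_transfer (N1 N2 : ('rV[R]_n -> R[i]) -> \bar R) (c : R) phi :
  0 < c ->
  (forall tau C, 0 < tau -> 0 < C -> seminorm_bounds sigma N1 tau C phi ->
    exists2 C', 0 < C' & seminorm_bounds sigma N2 (c * tau) C' phi) ->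
  (forall tau, 0 < tau ->
    exists2 C, 0 < C & seminorm_bounds sigma N1 tau C phi) ->
  forall tau, 0 < tau ->
    exists2 C, 0 < C & seminorm_bounds sigma N2 tau C phi.
Proof.
move=> c0 H HN1 tau t0; have tc0 : 0 < tau / c by rewrite divr_gt0.
have [C C0 /(H _ _ tc0 C0)] := HN1 _ tc0.
by rewrite mulrC divfK// gt_eqF.
Qed.

End transfer.

Theorem theorem3p5 (R : realType) (n : nat) (hn : (0 < n)%N) (sigma : R)
    (hsigma : 1 < sigma) :
  roumieu_space n sigma = roumieu_space_L2 n sigma /\
  beurling_space n sigma = beurling_space_L2 n sigma.
Proof.
have c0 : 0 < 2 `^ (sigma + 1) :> R by rewrite powR_gt0.
split; apply/seteqP; split=> phi [sphi H]; split=> //.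
- apply: Roumieu_transfer c0 _ H => tau C t0 C0.
  exact: seminorm_bounds_sup_L2.
- apply: Roumieu_transfer c0 _ H => tau C t0 C0.
  exact: seminorm_bounds_L2_sup.
- apply: Beurling_transfer c0 _ H => tau C t0 C0.
  exact: seminorm_bounds_sup_L2.
- apply: Beurling_transfer c0 _ H => tau C t0 C0.
  exact: seminorm_bounds_L2_sup.
Qed.
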